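(* Let $n\ge1$ and let $p_1,\dots,p_n>0$ and $q_1,\dots,q_n\ge0$ be integers. Then there exist polynomials $G_0(t,z),\dots,G_n(t,z)\in\mathbb Z[t,z]$ such that for every $\zeta\in\mathbb C$ the polynomials $G_0(t,\zeta),\dots,G_n(t,\zeta)\in\mathbb C[t]$ are not all zero, and for every integer $t\ge0$ $$\sum_{l=0}^nG_l(t,z)\,\mathcal L_n\big(p_1(t+l),q_1(t+l);\dots;p_n(t+l),q_n(t+l);z\big)=0$$ identically in $z$. Furthermore, if $n\ge2$ and $p_1\le p_2\le\cdots\le p_{m+1}$, $q_1\le q_2\le\cdots\le q_{m+1}$ for some $1\le m<n$, then for every integer $t\ge0$ $$\sum_{l=0}^nG_l(t,z)\,\mathbf T^m\Big(\mathcal L_n\big(p_1(t+l),q_1(t+l);\dots;p_n(t+l),q_n(t+l);z\big)\Big)=0.$$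
   Context: For an integer $k\ge0$, $D_k f(u)=\frac1{k!}\frac{d^k}{du^k}f(u)$. For integers $p_1,q_1,\dots,p_n,q_n\ge0$ the multiple Legendre polynomials are defined recursively by $\mathcal L_0(z)=1$ and $\mathcal L_n(p_1,q_1;\dots;p_n,q_n;z)=z^{q_n}(1-z)^{p_n}D_{p_n+q_n}\big(z^{p_n}(1-z)^{q_n}\mathcal L_{n-1}(p_1,q_1;\dots;p_{n-1},q_{n-1};z)\big)$, differentiation being in $z$. $\mathbf T:\mathbb C[z]\to\mathbb C[z]$ is the linear map $\mathbf T(P)(z)=\int_0^1\frac{P(z)-P(y)}{z-y}\,dy$, and $\mathbf T^m$ is its $m$-fold iterate. *)

(* Defs.v *)
From mathcomp Require Import all_boot all_order all_algebra.
From mathcomp Require Import complex.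
From mathcomp Require Import all_classical all_reals all_analysis.
From mathcomp Require Import measurable_realfun.
Set Implicit Arguments.
Unset Strict Implicit.
Unset Printing Implicit Defensive.
Import Order.TTheory GRing.Theory Num.Theory numFieldNormedType.Exports.

Local Open Scope ring_scope.
Local Open Scope complex_scope.
Local Open Scope classical_set_scope.

(* Not the numClosedFieldType projections Num.Re and Num.Im, which take values
   in R[i] itself. *)
Local Notation Re := complex.Re.
Local Notation Im := complex.Im.

(* The sequences p and q are indexed from 1; only p 1, .., p n and
   q 1, .., q n matter for multLegendre p q n. [^`N(k)] is the divided
   derivative D_k (see nderivn_def). *)
Fixpoint multLegendre (K : comNzRingType) (p q : nat -> nat) (n : nat)
  : {poly K} :=
  if n is n'.+1 then
    'X^(q n) * (1 - 'X) ^+ (p n) *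
    ('X^(p n) * (1 - 'X) ^+ (q n) * multLegendre K p q n')^`N(p n + q n)
  else 1.

(* Elements of Z[t, z] are represented as {poly {poly int}}, the outer variable
   being t and the inner one z. polyAtZ G zeta is G(t, zeta) in C[t], and
   polyAtT R G t is G(t, z) in C[z], for an integer t. *)
Definition polyAtZ (R : realType) (G : {poly {poly int}}) (zeta : R[i])
  : {poly R[i]} :=
  map_poly (fun c : {poly int} => (map_poly intr c).[zeta]) G.

Definition polyAtT (R : realType) (G : {poly {poly int}}) (t : nat)
  : {poly R[i]} :=
  map_poly intr G.[t%:R].

Definition cintegral01 (R : realType) (f : R -> R[i]) : R[i] :=
  (\int[@lebesgue_measure R]_(y in `[0, 1]) Re (f y)) +i*
  (\int[@lebesgue_measure R]_(y in `[0, 1]) Im (f y)).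

(* When z lies in [0, 1] the integrand below takes the junk value 0 at the
   removable singularity y = z, which is Lebesgue-negligible. *)
Definition Tval (R : realType) (P : {poly R[i]}) (z : R[i]) : R[i] :=
  cintegral01 (fun y : R => (P.[z] - P.[y%:C]) / (z - y%:C)).

(* The polynomial whose values are given by Tval; TmapE shows that it exists,
   so that the default value 0 is never used. *)
Definition Tmap (R : realType) (P : {poly R[i]}) : {poly R[i]} :=
  xget 0 [set Q : {poly R[i]} | forall z, Q.[z] = Tval P z].

Section TmapE.
Variable R : realType.
Local Notation mu := (@lebesgue_measure R).
Local Notation D := (`[0, 1]%classic : set R).
Implicit Types (P Q : {poly R[i]}) (r s : {poly R}).

Let ReM (x y : R[i]) : Re (x * y) = Re x * Re y - Im x * Im y.
Proof. by case: x y => [a b] [c d]. Qed.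
Let ImM (x y : R[i]) : Im (x * y) = Re x * Im y + Im x * Re y.
Proof. by case: x y => [a b] [c d]. Qed.
Let ReD (x y : R[i]) : Re (x + y) = Re x + Re y.
Proof. by case: x y => [a b] [c d]. Qed.
Let ImD (x y : R[i]) : Im (x + y) = Im x + Im y.
Proof. by case: x y => [a b] [c d]. Qed.

Let ReIm_poly Q : exists rs : {poly R} * {poly R}, forall y : R,
  Re Q.[y%:C] = rs.1.[y] /\ Im Q.[y%:C] = rs.2.[y].
Proof.
elim/poly_ind: Q => [|Q c [[r s] /= IH]].
  by exists (0, 0) => y /=; rewrite !horner0.
exists (r * 'X + (Re c)%:P, s * 'X + (Im c)%:P) => y /=.
have [Hr Hs] := IH y.
by rewrite !hornerE ReD ImD ReM ImM /= Hr Hs !mulr0 subr0 add0r.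
Qed.

Let int_poly r : mu.-integrable D (EFin \o (fun y => r.[y])).
Proof.
apply: continuous_compact_integrable; first exact: segment_compact.
by apply: continuous_subspaceT => y; exact: continuous_horner.
Qed.

Let int_ae (f : R -> R) r (x : R) : (forall y, y != x -> f y = r.[y]) ->
  \int[mu]_(y in D) f y = \int[mu]_(y in D) r.[y].
Proof.
move=> fr.
have fE : f = (fun y => r.[y] + (f x - r.[x]) * \1_[set x] y).
  apply/funext => y; rewrite indicE; have [->|yx] := eqVneq y x.
    by rewrite mem_set//= mulr1 addrC subrK.
  rewrite memNset ?mulr0 ?addr0 ?fr// => /=; exact/eqP.
have mr : measurable_fun D (fun y => r.[y]).
  by apply/measurable_EFinP; case/integrableP: (int_poly r).
congr fine; apply: ae_eq_integral => //.
- apply/measurable_EFinP; rewrite fE; apply: measurable_funD => //.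
  by apply: measurable_funM => //; exact: measurable_indic.
- exact/measurable_EFinP.
- exists [set x]; split => //=; first exact: lebesgue_measure_set1.
  move=> y /= H; apply: contrapT => /eqP yx; apply: H => _.
  by rewrite fr.
Qed.

Let cint Q : R[i] := cintegral01 (fun y => Q.[y%:C]).

Let cint0 : cint 0 = 0.
Proof.
rewrite /cint /cintegral01.
have H : \int[mu]_(y in D) (0 : R) = 0 by rewrite Rintegral_cst// mul0r.
by under eq_Rintegral do rewrite horner0; rewrite H;
   under eq_Rintegral do rewrite horner0; rewrite H.
Qed.

Let cintZD (c : R[i]) P Q : cint (c *: P + Q) = c * cint P + cint Q.
Proof.
have [[r s] /= rsP] := ReIm_poly P; have [[t u] /= tuQ] := ReIm_poly Q.
case: c => a b; rewrite /cint /cintegral01.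
under eq_Rintegral => y _ do
  rewrite hornerD hornerZ ReD ReM (rsP y).1 (rsP y).2 (tuQ y).1.
under [X in _ +i* X = _]eq_Rintegral => y _ do
  rewrite hornerD hornerZ ImD ImM (rsP y).1 (rsP y).2 (tuQ y).2.
under [X in _ = _ * (X +i* _) + _]eq_Rintegral => y _ do rewrite (rsP y).1.
under [X in _ = _ * (_ +i* X) + _]eq_Rintegral => y _ do rewrite (rsP y).2.
under [X in _ = _ + (X +i* _)]eq_Rintegral => y _ do rewrite (tuQ y).1.
under [X in _ = _ + (_ +i* X)]eq_Rintegral => y _ do rewrite (tuQ y).2.
have E v w x d e : \int[mu]_(y in D) (d * v.[y] + e * w.[y] + x.[y]) =
    d * (\int[mu]_(y in D) v.[y]) + e * (\int[mu]_(y in D) w.[y])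
    + \int[mu]_(y in D) x.[y].
  have I f g : mu.-integrable D (EFin \o (fun y => f * g.[y])).
    have := int_poly (f *: g); apply: eq_integrable => // y _ /=.
    by rewrite hornerZ.
  rewrite RintegralD//; first by rewrite RintegralD// !RintegralZl.
  have := int_poly (d *: v + e *: w); apply: eq_integrable => // y _ /=.
  by rewrite hornerD !hornerZ.
have EN v w x d e : \int[mu]_(y in D) (d * v.[y] - e * w.[y] + x.[y]) =
    d * (\int[mu]_(y in D) v.[y]) - e * (\int[mu]_(y in D) w.[y])
    + \int[mu]_(y in D) x.[y].
  rewrite -mulNr -E; apply: eq_Rintegral => y _.
  by rewrite mulNr.
by rewrite /= EN E.
Qed.

Let divdiff P : exists nA : nat * (nat -> {poly R[i]}), forall z y,
  P.[z] - P.[y] = (z - y) * \sum_(i < nA.1) z ^+ i * (nA.2 i).[y].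
Proof.
elim/poly_ind: P => [|P c [[n A] /= IH]].
  by exists (0%N, fun=> 0) => z y; rewrite big_ord0 !horner0 subrr mulr0.
exists (n.+1, fun i => if i is j.+1 then A j else P) => z y /=.
rewrite big_ord_recl /= expr0 mul1r.
under eq_bigr => i _ do rewrite exprS -mulrA.
rewrite -mulr_sumr [RHS]mulrDr [in RHS]mulrCA -IH !hornerE.
rewrite opprD addrACA subrr addr0 [in RHS]addrC mulrBr mulrBl addrA subrK.
by rewrite [P.[z] * z]mulrC [P.[y] * y]mulrC.
Qed.

Lemma Tmap_exists P : exists Q : {poly R[i]}, forall z, Q.[z] = Tval P z.
Proof.
have [[n A] /= PA] := divdiff P.
exists (\sum_(i < n) (cint (A i)) *: 'X^i) => z.
set B := \sum_(i < n) z ^+ i *: A i.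
transitivity (cint B).
  rewrite horner_sum /B; elim/big_rec2: _ => [|i u v _ ->]; first by rewrite cint0.
  by rewrite cintZD hornerZ hornerXn mulrC.
have BE y : z != y%:C -> (P.[z] - P.[y%:C]) / (z - y%:C) = B.[y%:C].
  move=> zy; rewrite PA mulrC mulKf ?subr_eq0// /B horner_sum.
  by apply: eq_bigr => i _; rewrite hornerZ.
have zE y : y != Re z -> z != y%:C.
  by apply: contraNN => /eqP ->.
have [[r s] /= rs] := ReIm_poly B.
rewrite /Tval /cint /cintegral01; congr (_ +i* _); apply/esym.
- rewrite (@int_ae _ r (Re z)); first by apply: eq_Rintegral => y _; rewrite (rs y).1.
  by move=> y /zE /BE ->; rewrite (rs y).1.
- rewrite (@int_ae _ s (Re z)); first by apply: eq_Rintegral => y _; rewrite (rs y).2.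
  by move=> y /zE /BE ->; rewrite (rs y).2.
Qed.

Lemma TmapE P z :
  (Tmap P).[z] = cintegral01 (fun y : R => (P.[z] - P.[y%:C]) / (z - y%:C)).
Proof.
have [Q HQ] := Tmap_exists P.
exact: (@xgetPex _ 0 [set Q : {poly R[i]} | forall z, Q.[z] = Tval P z]
          (ex_intro _ Q HQ) z).
Qed.

End TmapE.

(* Main.v *)
(* Let E be the linear map C[z] -> C[s] with E((z - 1)^i) = binom(s, i), so that
   E(f)(N) = [x^N] (1 + x)^N f(1 + x). It turns multiplication by z / (z - 1)
   into the shift s -> s + 1, turns T into d/ds, and maps
   z^q (1 - z)^p D_(p+q)(z^p (1 - z)^q f) to
   (-1)^(p+q) binom(s + q, p + q) E(f)(s). Hence E(L_n) is, up to a constant, a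
   product of n shifted rising factorials h_t(s). With d = n sum_i (p_i + q_i),
   the (n + 1)(d + 1) shifts h_(t+l)(s + j), l <= n, j <= d, are multiples of a
   common factor with cofactors of degree at most (n + 1) d in s, so they are
   linearly dependent over Z[t]: sum g_lj(t) h_(t+l)(s + j) = 0. Differentiating
   m times in s and undoing E gives the relation with coefficients
   sum_j g_lj(t) z^j (z - 1)^(d-j), for T^m(L_n) / (z - 1)^d; the division is
   exact because, for t >= d, h_t has a zero of order n > m at each
   s = 0, .., d - 1. Finally, dividing all coefficients by their common factor
   in Q[z] makes them generate the unit ideal of Q[z], so they have no common
   zero zeta. *)
Require Import Defs.
From HB Require Import structures.
From mathcomp Require Import all_boot all_order all_algebra.
From mathcomp Require Import complex.
From mathcomp Require Import all_classical all_reals all_analysis.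
From mathcomp Require Import zify ring.
Set Implicit Arguments.
Unset Strict Implicit.
Unset Printing Implicit Defensive.
Import Order.TTheory GRing.Theory Num.Theory numFieldNormedType.Exports.
Local Open Scope ring_scope.
Local Open Scope complex_scope.

(** * The Newton transform E and its intertwining relations *)

Section NewtonTransform.
Variable K : numFieldType.
Implicit Types (f g P : {poly K}) (N : nat).

(** A nonzero difference has fewer roots than its size, and integers are distinct in characteristic
    zero. The threshold [N0] admits identities checked only at large [N]. *)
Lemma poly_eq_nat N0 f g :
  (forall N, (N0 <= N)%N -> f.[N%:R] = g.[N%:R]) -> f = g.
Proof.
move=> fg; apply/eqP; rewrite -subr_eq0; apply/eqP.
pose rs : seq K := [seq i%:R | i <- iota N0 (size (f - g))].
apply: (@roots_geq_poly_eq0 _ _ rs); last by rewrite size_map size_iota.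
- apply/allP => _ /mapP[i + ->]; rewrite mem_iota => /andP[Ni _].
  by rewrite rootE hornerD hornerN fg// subrr.
- by rewrite map_inj_uniq ?iota_uniq// => i j /eqP; rewrite eqr_nat => /eqP.
Qed.

Definition binpoly (i : nat) : {poly K} :=
  (i`!%:R)^-1 *: \prod_(a < i) ('X - a%:R%:P).

Lemma binpoly_nat i N : (binpoly i).[N%:R] = 'C(N, i)%:R.
Proof.
have F : (i`!%:R : K) != 0 by rewrite pnatr_eq0 -lt0n fact_gt0.
apply: (mulIf F); rewrite -natrM bin_ffact hornerZ mulrAC mulVf// mul1r.
rewrite horner_prod; elim: i {F} => [|i IH]; first by rewrite big_ord0.
rewrite big_ord_recr /= IH !hornerE ffactnSr natrM.
case: (leqP i N) => iN; first by rewrite natrB.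
by rewrite ffact_small// !mul0r.
Qed.

Lemma exp_shift_coef N j : (('X + 1 : {poly K}) ^+ N)`_j = 'C(N, j)%:R.
Proof.
rewrite addrC exprDn coef_sum.
under eq_bigr => i _ do rewrite expr1n mul1r coefMn coefXn.
case: (ltnP j N.+1) => jN; last first.
  rewrite bin_small// big1// => i _.
  by rewrite gtn_eqF ?mul0rn// (leq_trans (ltn_ord i)).
rewrite (bigD1 (Ordinal jN))//= eqxx mulr1n big1 ?addr0// => i ij.
by rewrite eq_sym -[j]/(val (Ordinal jN)) (inj_eq val_inj) (negPf ij) mul0rn.
Qed.

(** This is the map E; composing with ['X + 1] gives the expansion in powers of z - 1. *)
Definition newton f : {poly K} :=
  let g := f \Po ('X + 1) in \sum_(i < size g) g`_i *: binpoly i.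

(** By binom(N, i) = binom(N, N - i), the value at N is a convolution with the coefficients of (1 +
    x)^N, so identities for E become comparisons of coefficients. *)
Lemma newton_nat f N :
  (newton f).[N%:R] = ((f \Po ('X + 1)) * ('X + 1) ^+ N)`_N.
Proof.
rewrite /newton; set g := f \Po _; rewrite horner_sum coefM.
under eq_bigr => i _ do rewrite hornerZ binpoly_nat.
under [RHS]eq_bigr => i _ do
  rewrite exp_shift_coef bin_sub -1?ltnS ?ltn_ord//.
pose F i := g`_i * 'C(N, i)%:R : K; pose M := maxn (size g) N.+1.
rewrite (big_ord_widen M F) ?leq_maxl// (big_ord_widen M F) ?leq_maxr// /F.
rewrite big_mkcond [RHS]big_mkcond; apply: eq_bigr => i _.
case: (ltnP i N.+1) => iN.
  by case: ltnP => // /(nth_default 0) ->; rewrite mul0r.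
by rewrite bin_small// mulr0 if_same.
Qed.

Lemma newtonD f g : newton (f + g) = newton f + newton g.
Proof.
apply: (@poly_eq_nat 0) => N _.
by rewrite hornerD !newton_nat comp_polyD mulrDl coefD.
Qed.

Lemma newtonZ (c : K) f : newton (c *: f) = c *: newton f.
Proof.
apply: (@poly_eq_nat 0) => N _.
by rewrite hornerZ !newton_nat comp_polyZ -scalerAl coefZ.
Qed.

Lemma newtonC (c : K) : newton c%:P = c%:P.
Proof.
apply: (@poly_eq_nat 0) => N _.
by rewrite newton_nat comp_polyC mul_polyC coefZ exp_shift_coef binn mulr1 hornerC.
Qed.

Lemma newton_sum (I : finType) (F : I -> {poly K}) :
  newton (\sum_i F i) = \sum_i newton (F i).
Proof. by apply: (big_morph newton newtonD); rewrite -[0]/(0%:P) newtonC. Qed.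

(* Multiplication by z / (z - 1) becomes the shift of the argument. *)
Lemma newton_shift f :
  newton ('X * f) = newton (('X - 1) * f) \Po ('X + 1).
Proof.
apply: (@poly_eq_nat 0) => N _.
rewrite horner_comp !hornerE natr1 !newton_nat !comp_polyM comp_polyB comp_polyX.
rewrite -[1]/(1%:P) comp_polyC addrK.
rewrite -['X * _ * _]mulrA coefXM /= exprS; congr (_ `_ N); congr polyseq; ring.
Qed.

(** The shift iterated j times, with the denominator of (z / (z - 1))^j cleared by (z - 1)^d. *)
Lemma newton_shiftn d j f : (j <= d)%N ->
  newton ('X^j * ('X - 1) ^+ (d - j) * f) =
  newton (('X - 1) ^+ d * f) \Po ('X + j%:R).
Proof.
elim: j f => [|j IH] f jd.
  by rewrite mul1r subn0 addr0 comp_polyXr.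
have -> : 'X^(j.+1) * ('X - 1) ^+ (d - j.+1) * f =
    'X * ('X^j * ('X - 1) ^+ (d - j.+1) * f) by rewrite exprS !mulrA.
rewrite newton_shift.
have -> : ('X - 1) * ('X^j * ('X - 1) ^+ (d - j.+1) * f) =
    'X^j * ('X - 1) ^+ (d - j) * f.
  have -> : (d - j)%N = (d - j.+1).+1 by lia.
  by rewrite exprS; ring.
by rewrite IH ?(ltnW jd)// -comp_polyA comp_polyD comp_polyX rmorph_nat -addrA nat1r.
Qed.

Lemma derivn_shift (c : nat) m f :
  (f \Po ('X + c%:R))^`(m) = f^`(m) \Po ('X + c%:R).
Proof.
elim: m => [|m IH] //; rewrite !derivnS IH deriv_comp derivD derivX.
by rewrite -(rmorph_nat polyC) derivC addr0 mulr1.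
Qed.

Lemma nderivn_shift k g :
  g^`N(k) \Po ('X + 1) = (g \Po ('X + 1))^`N(k).
Proof.
have := derivn_shift 1 k g; rewrite mulr1n => D.
have k0 : (k`!%:R : K) != 0 by rewrite pnatr_eq0 -lt0n fact_gt0.
apply: (scalerI k0); rewrite [RHS]scaler_nat -nderivn_def D nderivn_def.
by rewrite -[in RHS]scaler_nat comp_polyZ.
Qed.

(** Both sides equal (M + k)! / (k! j! (M - j)!). *)
Lemma bin_trinomial M k j : (j <= M)%N ->
  ('C(M + k, M - j) * 'C(k + j, k) = 'C(M + k, k) * 'C(M, M - j))%N.
Proof.
move=> jM; pose F := (k`! * j`! * (M - j)`!)%N.
have F0 : (0 < F)%N by rewrite !muln_gt0 !fact_gt0.
apply/eqP; rewrite -(eqn_pmul2r F0) /F.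
have := bin_fact (leq_addl M k); have := bin_fact (leq_subr j M).
have := bin_fact (leq_addr j k).
have /bin_fact : (M - j <= M + k)%N by lia.
rewrite addKn addnK subKn// (_ : M + k - (M - j) = k + j)%N; last by lia.
move=> e1 e2 e3 e4; apply/eqP; transitivity ((M + k)`!).
  by rewrite -e1 -e2; ring.
by rewrite -e4 -e3; ring.
Qed.

(** On the right, coefficients of [g] below degree k meet binom(M, i) with i > M and drop out; in
    degree k + j the claim is [bin_trinomial]. *)
Lemma coef_shift_nderivn M k g :
  (('X + 1) ^+ (M + k) * g^`N(k))`_M =
  'C(M + k, k)%:R * (('X + 1) ^+ M * g)`_(M + k).
Proof.
rewrite [(M + k)%N]addnC !coefMr -addnS [in RHS]big_split_ord /=.
rewrite [X in _ = _ * (X + _)]big1 => [|i _]; last first.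
  by rewrite exp_shift_coef bin_small ?mul0r//; have := ltn_ord i; lia.
rewrite add0r mulr_sumr; apply: eq_bigr => i _.
have iM : (i <= M)%N by rewrite -ltnS.
rewrite !exp_shift_coef coef_nderivn -[g`__ *+ _]mulr_natl !mulrA -!natrM.
by rewrite subnDl [(k + M)%N]addnC bin_trinomial.
Qed.

Definition legendre_step p q f : {poly K} :=
  'X^q * (1 - 'X) ^+ p * ('X^p * (1 - 'X) ^+ q * f)^`N(p + q).

(** After z = 1 + x, the outer x^p lowers the index from N to N - p, and the outer (1 + x)^q
    completes the exponent (N - p) + (p + q) required by [coef_shift_nderivn]. The inner x^q then
    lowers the index from N + q to N. *)
Lemma newton_legendre_step p q f :
  newton (legendre_step p q f) =
  (-1) ^+ (p + q) *: ((binpoly (p + q) \Po ('X + q%:R)) * newton f).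
Proof.
apply: (@poly_eq_nat p) => N pN.
rewrite hornerZ hornerM horner_comp.
have -> : ('X + q%:R : {poly K}).[N%:R] = (N + q)%:R.
  by rewrite hornerD hornerX hornerMn hornerC natrD.
rewrite binpoly_nat !newton_nat.
have XE a : (1 - 'X : {poly K}) ^+ a \Po ('X + 1) = (-1) ^+ a *: 'X^a.
  rewrite rmorphXn /= comp_polyB comp_polyX -[1]/(1%:P) comp_polyC.
  by rewrite opprD addrCA subrr addr0 -scaleN1r exprZn.
have XnE a : 'X^a \Po ('X + 1 : {poly K}) = ('X + 1) ^+ a.
  by rewrite rmorphXn /= comp_polyX.
rewrite /legendre_step !comp_polyM nderivn_shift !comp_polyM !XE !XnE.
set F := f \Po _; set g := ('X + 1) ^+ p * 'X^q * F.
have -> : ('X + 1) ^+ p * ((-1) ^+ q *: 'X^q) * F = (-1) ^+ q *: g.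
  by rewrite -scalerAr -scalerAl.
rewrite nderivnZ.
have -> : ('X + 1) ^+ q * ((-1) ^+ p *: 'X^p) *
    ((-1) ^+ q *: g^`N(p + q)) * ('X + 1) ^+ N =
    (-1) ^+ (p + q) *: ('X^p * (('X + 1) ^+ (N - p + (p + q)) * g^`N(p + q))).
  have -> : (N - p + (p + q) = q + N)%N by lia.
  rewrite !exprD -!mul_polyC rmorphM /=.
  ring.
rewrite coefZ coefXnM ltnNge pN /= coef_shift_nderivn addnA subnK//.
have -> : ('X + 1) ^+ (N - p) * g = 'X^q * (F * ('X + 1) ^+ N).
  by rewrite -[in RHS](subnK pN) exprD /g; ring.
by rewrite coefXnM ltnNge leq_addl /= addnK.
Qed.

(** Since z - (z - 1) = 1, the forward difference undoes multiplication by z - 1. *)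
Lemma newton_diff f :
  newton (('X - 1) * f) \Po ('X + 1) - newton (('X - 1) * f) = newton f.
Proof.
rewrite -newton_shift; apply/eqP; rewrite subr_eq addrC -newtonD; apply/eqP.
by congr newton; ring.
Qed.

Lemma newton_at0 f : (newton f).[0] = f.[1].
Proof.
have := newton_nat f 0; rewrite mulr0n expr0 mulr1 => ->.
by rewrite -horner_coef0 horner_comp !hornerE.
Qed.

Lemma newton_mul0 f : (newton (('X - 1) * f)).[0] = 0.
Proof. by rewrite newton_at0 !hornerE subrr mul0r. Qed.

(** E(f)(0) = f(1), so a factor z - 1 splits off; the transform of the quotient is the forward
    difference of E(f), which vanishes at all N < d - 1. *)
Lemma newton_dvd d f : (forall N, (N < d)%N -> (newton f).[N%:R] = 0) ->
  exists g, f = ('X - 1) ^+ d * g.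
Proof.
elim: d f => [|d IH] f fd; first by exists f; rewrite mul1r.
have /factor_theorem[g fE] : root f 1 by rewrite rootE -newton_at0 (fd 0).
rewrite mulrC in fE.
have [|h hE] := IH g.
  move=> N Nd; rewrite -newton_diff -fE hornerD hornerN horner_comp.
  rewrite !hornerE natr1 !fd ?subrr//; lia.
by exists h; rewrite fE hE exprS mulrA.
Qed.

(** Otherwise (z - 1)^(size f) would divide a nonzero polynomial of smaller degree. *)
Lemma newton_eq0 f : newton f = 0 -> f = 0.
Proof.
move=> f0; have [|g fE] := @newton_dvd (size f) f.
  by move=> N _; rewrite f0 horner0.
have [g0|g0] := eqVneq g 0; first by rewrite fE g0 mulr0.
have := congr1 (fun P : {poly K} => size P) fE.
rewrite -polyC1 mulrC size_Mmonic ?monic_exp ?monicXsubC// size_exp_XsubC /=.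
rewrite addnS /= => /eqP.
by rewrite -[X in X == _]add0n eqn_add2r eq_sym size_poly_eq0 (negPf g0).
Qed.

(** At i = 0 the division by zero yields 0, so the constant term is 0. *)
Definition primitive f : {poly K} :=
  \poly_(i < (size f).+1) (f`_i.-1 / i%:R).

Lemma deriv_primitive f : (primitive f)^`() = f.
Proof.
apply/polyP => i; rewrite coef_deriv coef_poly ltnS.
case: ltnP => [_|/(nth_default 0) ->]; last by rewrite mul0rn.
by rewrite -[_ *+ _]mulr_natr divfK// pnatr_eq0.
Qed.

Definition integral01 f : K := (primitive f).[1] - (primitive f).[0].

(** Write f - f(0) = z g: by [newton_shift], E(z g)(-1) = E((z - 1) g)(0) = 0. *)
Lemma newton_at_minus1 f : (newton f).[-1] = f.[0].
Proof.
have /factor_theorem[g fE] : root (f - f.[0]%:P) 0.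
  by rewrite rootE !hornerE subrr.
rewrite -[f in LHS](subrK f.[0]%:P) fE subr0 mulrC newtonD newton_shift.
by rewrite newtonC hornerD horner_comp !hornerE addNr newton_mul0 add0r.
Qed.

(** Let F be a primitive of f and F - F(1) = (z - 1) H. Then E((z - 1) f)(s) = s E(H)(s - 1), whose
    derivative at 0 is E(H)(-1) = H(0) = F(1) - F(0). *)
Lemma deriv_newton_mul_at0 f :
  (newton (('X - 1) * f))^`().[0] = integral01 f.
Proof.
set F := primitive f.
have /factor_theorem[H FE] : root (F - F.[1]%:P) 1.
  by rewrite rootE !hornerE subrr.
have -> : newton (('X - 1) * f) = 'X * (newton H \Po ('X - 1)).
  apply: (@poly_eq_nat 0) => -[|N] _.
    by rewrite hornerM hornerX newton_mul0 mul0r.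
  rewrite hornerM hornerX horner_comp.
  have -> : ('X - 1 : {poly K}).[N.+1%:R] = N%:R.
    by rewrite !hornerE -natr1 addrK.
  rewrite !newton_nat comp_polyM comp_polyB comp_polyX.
  rewrite -[1]/(1%:P) comp_polyC addrK -mulrA coefXM /= polyC1.
  (* With f written as a first divided derivative, [coef_shift_nderivn] for k = 1 produces the
     factor N + 1. *)
  have -> : f = (F - F.[1]%:P)^`N(1).
    by rewrite nderivn1 derivB derivC subr0 deriv_primitive.
  rewrite nderivn_shift mulrC -addn1 coef_shift_nderivn bin1.
  rewrite FE comp_polyM comp_polyB comp_polyX comp_polyC polyC1 addrK.
  by rewrite addn1 mulrA coefMX /= [('X + 1) ^+ N * _]mulrC.
rewrite derivM derivX mul1r hornerD hornerM hornerX mul0r addr0 horner_comp.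
rewrite !hornerE ?sub0r ?add0r newton_at_minus1 /integral01 -/F.
have := congr1 (fun P : {poly K} => P.[0]) FE; rewrite /= !hornerE.
by rewrite ?sub0r ?mulrN1 => E; rewrite -[LHS]opprK -E opprB.
Qed.

(** The hypotheses determine T by recursion on the degree, through f = (z - 1) g + f(1). *)
Lemma newton_integral_operator (T : {poly K} -> {poly K}) :
  (forall c, T c%:P = 0) ->
  (forall f c, T (('X - 1) * f + c%:P) = ('X - 1) * T f + (integral01 f)%:P) ->
  forall f, newton (T f) = (newton f)^`().
Proof.
move=> T0 TX f; have [n] := ubnP (size f); elim: n f => // n IH f fn.
have /factor_theorem[g fE] : root (f - f.[1]%:P) 1.
  by rewrite rootE !hornerE subrr.
have {}fE : f = ('X - 1) * g + f.[1]%:P.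
  by apply/eqP; rewrite -subr_eq fE mulrC.
have [g0|g0] := eqVneq g 0.
  by rewrite fE g0 mulr0 add0r T0 -[0]/(0%:P) newtonC newtonC derivC.
have gn : (size g < n)%N.
  have sg : size (('X - 1) * g) = (size g).+1.
    by rewrite -polyC1 mulrC size_Mmonic ?monicXsubC// size_XsubC addn2.
  rewrite -ltnS (leq_trans _ fn)// ltnS fE size_polyDl sg//.
  by rewrite (leq_ltn_trans (size_polyC_leq1 _))// ltnS size_poly_gt0.
rewrite fE TX !newtonD !newtonC derivD derivC addr0.
set U := newton _; set V := (newton _)^`().
(* By induction U and V have the same forward difference, so V - U is 1-periodic, hence constant;
   its value at 0 is the integral of g. *)
have UV : (V - U) \Po ('X + 1) = V - U.
  apply/eqP; rewrite -subr_eq0 comp_polyB.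
  have subrACA (a b c e : {poly K}) : a - b - (c - e) = (a - c) - (b - e) by ring.
  rewrite subrACA.
  rewrite newton_diff IH// -(newton_diff g) derivB deriv_comp.
  by rewrite derivD derivX -[1]/(1%:P) derivC addr0 mulr1 subrr.
suff : V - U = (integral01 g)%:P by move/eqP; rewrite subr_eq addrC => /eqP.
apply: (@poly_eq_nat 0) => N _; rewrite hornerC; elim: N => [|N IHN].
  by rewrite hornerD hornerN newton_mul0 subr0 deriv_newton_mul_at0.
by rewrite -IHN -[in RHS]UV horner_comp !hornerE natr1.
Qed.

End NewtonTransform.

(** * Integration over [0, 1] and the operator T *)

Lemma integral01_primitive (K : numFieldType) (F : {poly K}) :
  F.[1] - F.[0] = integral01 F^`().
Proof.
rewrite /integral01; set G := primitive _.
have D : (F - G)^`() = 0 by rewrite derivB deriv_primitive subrr.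
have FG : F - G = (F - G).[0]%:P.
  apply/polyP => -[|i]; rewrite coefC /= ?horner_coef0//.
  have := coef_deriv (F - G) i; rewrite D coef0 -mulr_natr => /esym/eqP.
  by rewrite mulf_eq0 pnatr_eq0 orbF => /eqP.
apply/eqP; rewrite -subr_eq0; apply/eqP.
transitivity ((F - G).[1] - (F - G).[0]); first by rewrite !hornerE; ring.
by rewrite [X in X.[1]]FG hornerC subrr.
Qed.

Lemma integral01_linear (K : numFieldType) (c : K) (f g : {poly K}) :
  integral01 (c *: f + g) = c * integral01 f + integral01 g.
Proof.
have <- : (c *: primitive f + primitive g)^`() = c *: f + g.
  by rewrite derivD derivZ !deriv_primitive.
by rewrite -integral01_primitive !hornerD !hornerZ /integral01; ring.
Qed.

Section Tmap.
Variable R : realType.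
Local Notation mu := (@lebesgue_measure R).

Lemma Rintegral01_poly (r : {poly R}) :
  (\int[mu]_(y in `[0, 1]) r.[y])%R = integral01 r.
Proof.
rewrite /Rintegral (@continuous_FTC2 R (horner r) (horner (primitive r)) 0 1).
- by [].
- by [].
- by apply: continuous_subspaceT => y; exact: continuous_horner.
- split => //=.
  + by apply: cvg_at_right_filter; exact: continuous_horner.
  + by apply: cvg_at_left_filter; exact: continuous_horner.
- by move=> x _; rewrite -derivE deriv_primitive.
Qed.

Lemma cintegral01_poly (P : {poly R[i]}) :
  cintegral01 (fun y : R => P.[y%:C]) = integral01 P.
Proof.
have [r [s PE]] : exists r s : {poly R},
    P = map_poly (real_complex R) r + 'i%C *: map_poly (real_complex R) s.
  elim/poly_ind: P => [|P [a b] [r [s ->]]].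
    by exists 0, 0; rewrite !rmorph0 scaler0 addr0.
  exists (r * 'X + a%:P), (s * 'X + b%:P).
  rewrite !rmorphD !rmorphM /= !map_polyX !map_polyC /=.
  rewrite (_ : (a +i* b) = a%:C + 'i%C * b%:C); last by simpc.
  rewrite polyCD polyCM -!mul_polyC; ring.
have PyE (y : R) : P.[y%:C] = r.[y] +i* s.[y].
  by rewrite PE !hornerE !horner_map /=; simpc.
rewrite /cintegral01.
under eq_Rintegral do rewrite PyE.
under [X in _ +i* X]eq_Rintegral do rewrite PyE.
rewrite /= !Rintegral01_poly PE.
pose F := map_poly (real_complex R) (primitive r)
  + 'i%C *: map_poly (real_complex R) (primitive s).
have <- : F.[1] - F.[0] = integral01 (map_poly (real_complex R) r
   + 'i%C *: map_poly (real_complex R) s).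
  by rewrite integral01_primitive derivD derivZ !deriv_map !deriv_primitive.
rewrite /F -(rmorph1 (real_complex R)) -(rmorph0 (real_complex R)).
rewrite !hornerD !hornerZ !horner_map /= /integral01.
by simpc.
Qed.

(** The points N + 2 lie outside [0, 1], so the integrand equals W at every y and no singularity
    arises. *)
Lemma Tmap_quotient (P W : {poly R[i]}) N :
  P - P.[N.+2%:R]%:P = W * ('X - N.+2%:R%:P) ->
  (Tmap P).[N.+2%:R] = integral01 W.
Proof.
move=> PW; rewrite TmapE -cintegral01_poly /cintegral01.
have E (y : R) : y \in `[0, 1] ->
    (P.[N.+2%:R] - P.[y%:C]) / (N.+2%:R - y%:C) = W.[y%:C].
  rewrite in_itv /= => /andP[_ y1].
  have Ny : N.+2%:R - y%:C != 0.
    rewrite subr_eq0 eq_sym -(rmorph_nat (real_complex R)) (inj_eq (@complexI R)).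
    by rewrite lt_eqF// (le_lt_trans y1)// ltr1n.
  have := congr1 (fun Q : {poly R[i]} => - Q.[y%:C]) PW.
  rewrite /= !hornerE opprB -mulrN opprB => ->; rewrite mulfK//.
by congr (_ +i* _); apply: eq_Rintegral => y; rewrite inE /= => /E ->.
Qed.

Lemma Tmap_newton (P : {poly R[i]}) : newton (Tmap P) = (newton P)^`().
Proof.
apply: newton_integral_operator => [c|f c].
  apply: (@poly_eq_nat _ 2) => -[|[|N]]// _; rewrite horner0.
  rewrite (@Tmap_quotient _ 0) ?hornerC ?subrr ?mul0r//.
  by have := integral01_primitive (0 : {poly R[i]}); rewrite deriv0 !horner0 subrr.
apply: (@poly_eq_nat _ 2) => -[|[|N]]// _.
have /factor_theorem[W fW] : root (f - f.[N.+2%:R]%:P) N.+2%:R.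
  by rewrite rootE !hornerE subrr.
rewrite hornerD hornerM hornerC (Tmap_quotient fW).
(* With a = N + 2: (y - 1) f(y) - (a - 1) f(a) = (a - 1) (f(y) - f(a)) + (y - a) f(y). *)
rewrite (@Tmap_quotient _ ((N.+2%:R - 1) *: W + f)); last first.
  have fE : f = W * ('X - N.+2%:R%:P) + f.[N.+2%:R]%:P by rewrite -fW subrK.
  rewrite !hornerE; set v := f.[_] in fE *; rewrite fE.
  rewrite -mul_polyC !(polyCD, polyCM, polyCB) polyC1; ring.
by rewrite integral01_linear !hornerE.
Qed.

Lemma iter_Tmap_newton m (P : {poly R[i]}) :
  newton (iter m (@Tmap R) P) = (newton P)^`(m).
Proof. by elim: m => // m IH; rewrite iterS Tmap_newton IH derivnS. Qed.
End Tmap.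

(** * Linear dependence and common factors of polynomials *)

(** Column N of the square coefficient matrix is zero by the size bound, so the determinant vanishes
    and a nonzero left kernel vector exists over the domain. *)
Lemma poly_dependence (D : idomainType) (I : finType) (F : I -> {poly D}) N :
  (forall i, (size (F i) <= N)%N) -> (N < #|I|)%N ->
  exists2 g : I -> D, exists i, g i != 0 & \sum_i g i *: F i = 0.
Proof.
move=> FN NI; pose A := \matrix_(r < #|I|, c < #|I|) (F (enum_val r))`_c.
have /eqP/det0P[v v0 vA] : \det A = 0.
  rewrite (expand_det_col _ (Ordinal NI)) big1// => r _.
  by rewrite mxE nth_default ?mul0r// FN.
exists (fun i => v 0 (enum_rank i)).
  move: v0; rewrite -subr_eq0 => /eqP v0.
  case: (pickP (fun i => v 0 (enum_rank i) != 0)) => [i ?|v00]; first by exists i.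
  case: v0; rewrite subr0; apply/rowP => r; rewrite mxE.
  by have /negbFE/eqP := v00 (enum_val r); rewrite enum_valK.
apply/polyP => c; rewrite coef0 coef_sum.
under eq_bigr => i _ do rewrite coefZ.
case: (ltnP c N) => cN; last first.
  by rewrite big1// => i _; rewrite nth_default ?mulr0// (leq_trans (FN i)).
have cI := ltn_trans cN NI.
have := congr1 (fun M : 'rV_#|I| => M 0 (Ordinal cI)) vA; rewrite !mxE => E.
rewrite -[RHS]E (reindex_onto enum_val enum_rank) => [|i _]; last exact: enum_rankK.
by apply: eq_big => r; rewrite ?enum_valK ?eqxx// mxE.
Qed.

(** [D] is a gcd over Q up to a scalar. The Bezout relation for the quotients is what excludes a
    common complex zero later. *)
Lemma remove_common_factor (I : finType) (c : I -> {poly int}) :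
  (exists i, c i != 0) ->
  exists D : {poly rat}, exists c' : I -> {poly int},
  [/\ D != 0,
      forall i, map_poly intr (c i) = D * map_poly intr (c' i) &
      exists u : I -> {poly rat}, \sum_i u i * map_poly intr (c' i) = 1].
Proof.
move=> [i0 ci0]; pose a i : {poly rat} := map_poly intr (c i).
have [g [u gE g_dvd]] : exists g, exists2 u : I -> {poly rat},
    g = \sum_i u i * a i & forall i, i \in enum I -> g %| a i.
  elim: (enum I) => [|x s [g [u gE g_dvd]]].
    by exists 0, (fun=> 0) => //; rewrite big1// => i _; rewrite mul0r.
  have [[e1 e2] /= /eqp_dvdl gcdE] := Bezoutp g (a x).
  exists (e1 * g + e2 * a x), (fun i => e1 * u i + (i == x)%:R * e2).
    under eq_bigr do rewrite mulrDl; rewrite big_split gE mulr_sumr /=.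
    congr (_ + _); first by apply: eq_bigr => i _; rewrite mulrA.
    rewrite (bigD1 x)//= eqxx mul1r big1 ?addr0// => i /negPf ->.
    by rewrite !mul0r.
  move=> i; rewrite inE gcdE => /predU1P[->|/g_dvd]; first exact: dvdp_gcdr.
  exact/dvdp_trans/dvdp_gcdl.
have {}g_dvd i : g %| a i by rewrite g_dvd// mem_enum.
have g0 : g != 0.
  apply: contraNneq ci0 => g0; have := g_dvd i0; rewrite g0 dvd0p.
  move=> /eqP ai0; apply/eqP/(map_inj_poly (@intr_inj rat)) => //.
  by rewrite rmorph0.
pose b i := a i %/ g.
have aE i : a i = g * b i by rewrite mulrC divpK.
pose q i := projT1 (rat_poly_scale (b i)).
have /all_sig[e eP] i : {e : int | e != 0 & b i = e%:~R^-1 *: map_poly intr (q i)}.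
  by rewrite /q; case: rat_poly_scale => /= r [e e0 bE]; exists e.
(* A common denominator [E] restores integer coefficients; its inverse is absorbed into [D]. *)
pose E : int := \prod_i e i; pose e' i : int := \prod_(k | k != i) e k.
have E0 : E%:~R != 0 :> rat.
  by rewrite intr_eq0; apply/prodf_neq0 => i _; case: (eP i).
have qE i : map_poly intr (e' i *: q i) = E%:~R *: b i.
  have [ei0 ->] := eP i.
  rewrite map_polyZ /= scalerA /E (bigD1 i)//= intrM mulrAC mulfV ?intr_eq0//.
  by rewrite mul1r.
exists (E%:~R^-1 *: g), (fun i => e' i *: q i); split.
- by rewrite scaler_eq0 invr_eq0 (negPf E0).
- by move=> i; rewrite qE -!mul_polyC mulrACA -polyCM mulVf// mul1r -aE.
exists (fun i => E%:~R^-1 *: u i); apply: (mulfI g0); rewrite mulr1 [in RHS]gE.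
rewrite mulr_sumr; apply: eq_bigr => i _.
by rewrite qE -!mul_polyC mulrACA -polyCM mulVf// mul1r aE mulrCA.
Qed.

(** At z = 0 only the term j = 0 survives; once it is removed, z divides the sum and the quotient is
    the case d - 1. *)
Lemma bernstein_free (D : idomainType) d (a : 'I_d.+1 -> D) :
  \sum_(j < d.+1) a j *: ('X^j * ('X - 1) ^+ (d - j)) = 0 -> forall j, a j = 0.
Proof.
elim: d a => [|d IH] a; rewrite big_ord_recl /=.
  rewrite big_ord0 addr0 mulr1 -mul_polyC mulr1 => /eqP; rewrite polyC_eq0.
  by move=> /eqP a0 j; rewrite ord1.
rewrite mul1r subn0 => E.
have a0 : a ord0 = 0.
  have := congr1 (fun P : {poly D} => P.[0]) E.
  rewrite /= hornerD hornerZ horner_exp horner_sum big1 => [|j _].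
    rewrite !hornerE ?sub0r => /eqP; rewrite mulf_eq0 expf_eq0 oppr_eq0 oner_eq0.
    by rewrite andbF orbF => /eqP.
  by rewrite !hornerE expr0n /= !(mul0r, mulr0).
move: E; rewrite a0 scale0r add0r.
under eq_bigr => j _ do rewrite exprS -mulrA scalerAr subSS.
rewrite -mulr_sumr => /eqP; rewrite mulf_eq0 polyX_eq0 /= => /eqP /IH aS j.
by case: (unliftP ord0 j) => [k ->|->].
Qed.

(** * Rising factorials and the transforms of multiple Legendre polynomials *)

Section Rise.
Variable R : comPzRingType.

Definition rise (y : R) (m : nat) : R := \prod_(a < m) (y + a%:R).

Lemma riseD y m k : rise y (m + k) = rise y m * rise (y + m%:R) k.
Proof.
rewrite /rise big_split_ord; congr (_ * _); apply: eq_bigr => a _.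
by rewrite natrD addrA.
Qed.

End Rise.

Lemma rise_morph (R S : comPzRingType) (f : {rmorphism R -> S}) y m :
  f (rise y m) = rise (f y) m.
Proof.
by rewrite rmorph_prod; apply: eq_bigr => a _; rewrite rmorphD rmorph_nat.
Qed.

Lemma fact_rise (K : numFieldType) m k :
  (m + k)`!%:R = m`!%:R * rise (m%:R + 1) k :> K.
Proof.
elim: k => [|k IH]; first by rewrite /rise addn0 big_ord0 mulr1.
rewrite addnS factS mulnC natrM IH /rise big_ord_recr /= mulrA.
by rewrite -natr1 natrD addrAC.
Qed.

Lemma size_rise_XaddC (D : idomainType) (c : D) m :
  size (rise ('X + c%:P) m) = m.+1.
Proof.
have -> : rise ('X + c%:P) m =
    \prod_(x <- enum 'I_m) ('X - (- (c + x%:R))%:P).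
  rewrite big_enum; apply: eq_bigr => a _.
  by rewrite polyCN opprK polyCD addrA rmorph_nat.
by rewrite size_prod_XsubC -cardE card_ord.
Qed.

Section NewtonLegendre.
Variable K : numFieldType.

Lemma binpoly_rise p q :
  binpoly K (p + q) \Po ('X + q%:R) =
  (p + q)`!%:R^-1 *: rise ('X + 1 - p%:R) (p + q).
Proof.
rewrite comp_polyZ rmorph_prod /=; congr (_ *: _).
(* Reversing the order turns the falling factors s + q - a into rising ones. *)
rewrite /rise (reindex_inj rev_ord_inj); apply: eq_bigr => a _ /=.
rewrite comp_polyB comp_polyX comp_polyC natrB// -natr1 natrD polyCB !polyCD.
rewrite polyC1 !rmorph_nat; ring.
Qed.

Definition legendre_const (p q : nat -> nat) n : K :=
  \prod_(i < n) ((-1) ^+ (p i.+1 + q i.+1) / (p i.+1 + q i.+1)`!%:R).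

Definition legendre_rise (p q : nat -> nat) n : {poly K} :=
  \prod_(i < n) rise ('X + 1 - (p i.+1)%:R) (p i.+1 + q i.+1).

Lemma newton_multLegendre (p q : nat -> nat) n :
  newton (multLegendre K p q n) =
  legendre_const p q n *: legendre_rise p q n.
Proof.
rewrite /legendre_const /legendre_rise.
elim: n => [|n IH]; first by rewrite !big_ord0 scale1r -polyC1 newtonC.
rewrite !big_ord_recr /=.
have := newton_legendre_step (p n.+1) (q n.+1) (multLegendre K p q n).
rewrite /legendre_step => ->; rewrite binpoly_rise IH -!mul_polyC !polyCM.
ring.
Qed.

Lemma dvdp_derivn (c : K) m k (f : {poly K}) :
  ('X - c%:P) ^+ (m + k) %| f -> ('X - c%:P) ^+ m %| f^`(k).
Proof.
elim: k f => [|k IH] f; first by rewrite addn0.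
rewrite addnS derivSn => /dvdpP[g ->]; apply: IH.
rewrite derivM; apply: dvdp_add; first by rewrite dvdp_mull// exprS dvdp_mull.
by rewrite deriv_exp -mulr_natl !mulrA dvdp_mull.
Qed.

(* The zero of order n at 0, ..., d - 1 survives fewer than n derivations. *)
Lemma root_derivn_legendre_rise (p q : nat -> nat) n d m :
  (forall i, (1 <= i <= n)%N -> (d <= p i)%N) -> (m < n)%N ->
  forall N, (N < d)%N -> (legendre_rise p q n)^`(m).[N%:R] = 0.
Proof.
move=> pd mn N Nd; apply/eqP; rewrite -[_ == 0]/(root _ _) -dvdp_XsubCl.
rewrite -[X in X %| _]expr1; apply: dvdp_derivn.
apply: (@dvdp_trans _ (('X - N%:R%:P) ^+ n)).
  by rewrite dvdp_exp2l// add1n.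
have -> : ('X - N%:R%:P : {poly K}) ^+ n = \prod_(i < n) ('X - N%:R%:P).
  by rewrite prodr_const card_ord.
apply: (big_rec2 (fun f g : {poly K} => f %| g)) => [|i f g _ fg].
  exact: dvdpp.
apply: dvdp_mul => //.
have pi : (N < p i.+1)%N by rewrite (leq_trans Nd)// pd//= ltn_ord.
(* In each of the n rising factorials, the factor of this index is s - N. *)
have aP : (p i.+1 - N.+1 < p i.+1 + q i.+1)%N by lia.
rewrite /rise (bigD1 (Ordinal aP))//= dvdp_mulr//.
suff -> : 'X + 1 - (p i.+1)%:R + (p i.+1 - N.+1)%:R = 'X - N%:R%:P :> {poly K}.
  exact: dvdpp.
by rewrite natrB// -natr1 rmorph_nat; ring.
Qed.

End NewtonLegendre.

Definition eval_int (K : numFieldType) (t : nat) : {poly int} -> K :=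
  intr \o horner_eval (t%:R : int).

HB.instance Definition _ (K : numFieldType) t :=
  GRing.RMorphism.copy (@eval_int K t) (intr \o horner_eval (t%:R : int)).

Lemma eval_intX (K : numFieldType) t : eval_int K t 'X = t%:R.
Proof. by rewrite /eval_int /= /horner_eval hornerX; exact: rmorph_nat. Qed.

(** * Recurrences in t, first for the transforms, then in z *)

Section Recurrence.
Variables (p q : nat -> nat) (n : nat).

Local Notation K_ := (\sum_(i < n) (p i.+1 + q i.+1))%N.
Local Notation d := (n * K_)%N.

(* Quotient of the shifts (t, s) -> (t + l, s + j) of the rising factorials in
   newton_multLegendre by common_rise; t is the variable of the coefficients. *)
Definition rise_ratio (l j : nat) : {poly {poly int}} :=
  \prod_(i < n)
    (rise ('X + (1 + j%:R - (p i.+1)%:R * ('X + l%:R))%:P) (d - j + p i.+1 * l) *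
     rise ('X + (1 + (q i.+1)%:R * 'X)%:P) (q i.+1 * l + j)).

(** For each i, these factors run from the largest lower end s + 1 + d - p_i t to the smallest upper
    end s + q_i t among the shifts with l >= 0 and 0 <= j <= d. *)
Definition common_rise (K : numFieldType) (t : nat) : {poly K} :=
  \prod_(i < n)
    rise ('X + 1 + d%:R - (p i.+1 * t)%:R) ((p i.+1 + q i.+1) * t - d).

(** [legendre_const] at t divided by its value at t + l, as a polynomial in t. *)
Definition const_ratio (l : nat) : {poly int} :=
  \prod_(i < n) ((-1) ^+ ((p i.+1 + q i.+1) * l) *
    rise ((p i.+1 + q i.+1)%:R * 'X + 1) ((p i.+1 + q i.+1) * l)).

Local Notation scaled f t := (fun i => (f i * t)%N).

(** The shift j cancels between the two blocks, so the degree is n d + l K_, at most (n + 1) d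
    because d = n K_. *)
Lemma size_rise_ratio l j : (l <= n)%N -> (j <= d)%N ->
  (size (rise_ratio l j) <= (n.+1 * d).+1)%N.
Proof.
move=> ln jd; rewrite size_prod => [|i _]; last first.
  by rewrite mulf_neq0// -size_poly_gt0 size_rise_XaddC.
set k := (\sum_(i < n) _)%N in jd *.
under eq_bigr => i _.
  rewrite size_mul -?size_poly_gt0 ?size_rise_XaddC//=.
  rewrite (_ : _ + _ = (n * k + (p i.+1 + q i.+1) * l) + 1)%N; last first.
    by rewrite mulnDl; lia.
  over.
have -> : (\sum_(i < n) (n * k + (p i.+1 + q i.+1) * l + 1) =
    n * n * k + k * l + n)%N.
  by rewrite !big_split /= !sum_nat_const !card_ord -big_distrl /= mulnA muln1.
by rewrite card_ord; nia.
Qed.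

Lemma const_ratio_neq0 l : const_ratio l != 0.
Proof.
apply/prodf_neq0 => i _; rewrite mulf_neq0 ?signr_eq0//.
apply/prodf_neq0 => a _; apply/eqP => /(congr1 (fun P : {poly int} => P.[0])).
rewrite /= !hornerD hornerM hornerX mulr0 add0r hornerMn -polyC1 hornerC.
by rewrite horner0 nat1r => /eqP; rewrite pnatr_eq0.
Qed.

Lemma const_ratioE (K : numFieldType) l t :
  eval_int K t (const_ratio l) *
    legendre_const K (scaled p (t + l)) (scaled q (t + l)) n =
  legendre_const K (scaled p t) (scaled q t) n.
Proof.
rewrite /const_ratio /legendre_const rmorph_prod -big_split /=.
apply: eq_bigr => i _; rewrite rmorphM rmorphXn rmorphN1 rise_morph.
rewrite -!mulnDl mulnDr; set k := (p i.+1 + q i.+1)%N.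
rewrite [X in rise X _](_ : _ = (k * t)%:R + 1); last first.
  rewrite rmorphD rmorphM rmorph1 rmorph_nat natrM; congr (_ * _ + _).
  exact: eval_intX.
rewrite fact_rise exprD.
have r0 : rise ((k * t)%:R + 1) (k * l) != 0 :> K.
  by apply/prodf_neq0 => a _; rewrite natr1 -natrD pnatr_eq0.
have k0 : (k * t)`!%:R != 0 :> K by rewrite pnatr_eq0 -lt0n fact_gt0.
have ee : (-1) ^+ (k * l) * (-1) ^+ (k * l) = 1 :> K.
  by rewrite -expr2 sqrr_sign.
move: r0 k0 ee; move: (rise _ _) (_`!%:R) ((-1) ^+ (k * l)) ((-1) ^+ (k * t)).
move=> r f e e' r0 f0 ee; rewrite -[RHS]mul1r -ee; field; exact/andP.
Qed.

(** Each rising factorial splits into a lower block, the common one and an upper block; d <= t and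
    p_i > 0 make the length (p_i + q_i) t - d a true subtraction. *)
Lemma rise_ratioE (K : numFieldType) l j t : (d <= t)%N -> (j <= d)%N ->
  (forall i, (1 <= i <= n)%N -> (0 < p i)%N) ->
  legendre_rise K (scaled p (t + l)) (scaled q (t + l)) n \Po ('X + j%:R) =
  map_poly (eval_int K t) (rise_ratio l j) * common_rise K t.
Proof.
move=> dt jd p0.
rewrite /legendre_rise /rise_ratio /common_rise.
rewrite [LHS]rmorph_prod [X in _ = X * _]rmorph_prod -big_split.
apply: eq_bigr => i _ /=.
rewrite [in RHS]rmorphM !rise_morph.
have pi0 : (0 < p i.+1)%N by rewrite p0//= ltn_ord.
move: (n * _)%N (p i.+1) (q i.+1) dt jd pi0 => D a b dt jd a0.
have Dt : (D <= (a + b) * t)%N by nia.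
have [m1 m1E] : {m | m = D - j + a * l}%N by eexists.
have [m2 m2E] : {m | m = (a + b) * t - D}%N by eexists.
have -> : (a * (t + l) + b * (t + l) = m1 + (m2 + (b * l + j)))%N.
  by rewrite m1E m2E mulnDl in Dt *; rewrite !mulnDr; lia.
rewrite -m1E -m2E.
have {}m1E : m1%:R = D%:R - j%:R + a%:R * l%:R :> {poly K}.
  by rewrite m1E natrD natrB// natrM.
have {}m2E : m2%:R = (a%:R + b%:R) * t%:R - D%:R :> {poly K}.
  by rewrite m2E natrB// natrM natrD.
have phiC (c : {poly int}) : map_poly (eval_int K t) ('X + c%:P) =
    'X + (eval_int K t c)%:P.
  by rewrite rmorphD /= map_polyX map_polyC.
rewrite (riseD _ m1) (riseD _ m2) mulrCA mulrA /= !phiC.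
rewrite rmorphB rmorphD rmorph1 rmorph_nat /= comp_polyX.
rewrite !(rmorphD, rmorphB, rmorphN, rmorphM, rmorph1, rmorph_nat) /= eval_intX.
rewrite !(rmorphD, rmorphB, rmorphN, rmorphM, rmorph1, rmorph_nat) /=.
rewrite mulrAC [RHS]mulrAC [X in _ = X * _]mulrC [RHS]mulrAC.
by congr (rise _ _ * rise _ _ * rise _ _); rewrite ?m1E ?m2E; ring.
Qed.

Lemma newton_recurrence : (0 < n)%N ->
    (forall i, (1 <= i <= n)%N -> (0 < p i)%N) ->
  exists2 g : 'I_n.+1 * 'I_d.+1 -> {poly int}, exists lj, g lj != 0 &
  forall (K : numFieldType) t, (d <= t)%N ->
  \sum_lj eval_int K t (g lj) *:
    (newton (multLegendre K (scaled p (t + lj.1)) (scaled q (t + lj.1)) n)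
      \Po ('X + lj.2%:R)) = 0.
Proof.
move=> n0 p0.
pose F (lj : 'I_n.+1 * 'I_d.+1) := rise_ratio lj.1 lj.2.
(* There are (n + 1) (d + 1) cofactors, more than the size bound (n + 1) d + 1 since n >= 1. *)
have [||g [lj glj] gF] := @poly_dependence _ _ F (n.+1 * d).+1.
- by move=> [l j]; rewrite size_rise_ratio// -ltnS ltn_ord.
- by rewrite card_prod !card_ord mulnS; lia.
(* The extra factor brings all normalising constants to the one at l = 0. *)
exists (fun lj => g lj * const_ratio lj.1).
  by exists lj; rewrite mulf_neq0// const_ratio_neq0.
move=> K t dt; pose C := legendre_const K (scaled p t) (scaled q t) n.
transitivity (C *: (map_poly (eval_int K t) (\sum_lj g lj *: F lj)
    * common_rise K t)); last by rewrite gF rmorph0 mul0r scaler0.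
rewrite rmorph_sum /= mulr_suml scaler_sumr; apply: eq_bigr => -[l j] _ /=.
rewrite newton_multLegendre comp_polyZ rise_ratioE//; last by rewrite -ltnS.
rewrite map_polyZ scalerA -scalerAl scalerA rmorphM -mulrA const_ratioE.
by rewrite [C * _]mulrC.
Qed.

End Recurrence.

(* Clearing the powers of z - 1 that divide the iterated images turns the
   recurrence for Newton transforms into one for polynomials in z. *)
Lemma legendre_recurrence (R : realType) (p q : nat -> nat) n :
  let d := (n * \sum_(i < n) (p i.+1 + q i.+1))%N in
  (0 < n)%N -> (forall i, (1 <= i <= n)%N -> (0 < p i)%N) ->
  exists2 g : 'I_n.+1 * 'I_d.+1 -> {poly int}, exists lj, g lj != 0 &
  forall t m, (m < n)%N ->
  \sum_lj (eval_int R[i] t (g lj) *: ('X^(lj.2) * ('X - 1) ^+ (d - lj.2))) *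
    iter m (@Tmap R) (multLegendre R[i] (fun i => p i * (t + lj.1))%N
                                        (fun i => q i * (t + lj.1))%N n) = 0.
Proof.
move=> d n0 p0; have [g [lj glj] gL] := newton_recurrence q n0 p0.
(* V annihilates the relations at the t < d, where newton_recurrence says
   nothing. *)
pose V : {poly int} := \prod_(a < d) ('X - a%:R%:P).
exists (fun lj => g lj * V).
  exists lj; rewrite mulf_neq0//; apply/prodf_neq0 => a _.
  by rewrite polyXsubC_eq0.
move=> t m mn; case: (ltnP t d) => [td|dt].
  have V0 : eval_int R[i] t V = 0.
    rewrite rmorph_prod (bigD1 (Ordinal td))//= rmorphB /= eval_intX.
    by rewrite rmorph_nat rmorph_nat subrr mul0r.
  by rewrite big1// => k _; rewrite rmorphM /= V0 mulr0 scale0r mul0r.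
pose L l := multLegendre R[i] (fun i => p i * (t + l))%N
                              (fun i => q i * (t + l))%N n.
have NL l : newton (iter m (@Tmap R) (L l)) = (newton (L l))^`(m).
  exact: iter_Tmap_newton.
have /all_sig[h hE] l : {h | iter m (@Tmap R) (L l) = ('X - 1) ^+ d * h}.
  apply: cid; apply: newton_dvd => N Nd.
  rewrite NL newton_multLegendre derivnZ hornerZ.
  rewrite (@root_derivn_legendre_rise _ _ _ _ d) ?mulr0// => i ip.
  rewrite (leq_trans dt)// (leq_trans (leq_addr l t))// leq_pmull//.
  exact: p0.
(* The relation divided by (z - 1)^d; its transform is the m-th derivative of the relation in
   [newton_recurrence], and E is injective. *)
pose Z := \sum_lj eval_int R[i] t (g lj) *:
  ('X^(lj.2) * ('X - 1) ^+ (d - lj.2) * h lj.1).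
have Z0 : Z = 0.
  apply: newton_eq0; rewrite newton_sum.
  transitivity ((\sum_lj eval_int R[i] t (g lj) *:
    (newton (L lj.1) \Po ('X + lj.2%:R)))^`(m)); last first.
    by rewrite gL// -polyC0 derivnC; case: (m).
  rewrite (big_morph _ (derivnD m) (linear0 _)); apply: eq_bigr => -[l j] _ /=.
  rewrite newtonZ newton_shiftn; last by rewrite -ltnS.
  by rewrite -hE NL derivnZ derivn_shift.
transitivity ((eval_int R[i] t V *: ('X - 1) ^+ d) * Z).
  rewrite mulr_sumr; apply: eq_bigr => -[l j] _ /=.
  by rewrite hE rmorphM -!mul_polyC polyCM; ring.
by rewrite Z0 mulr0.
Qed.

Theorem theorem4p1 (R : realType) (n : nat) (p q : nat -> nat)
  (hn : (1 <= n)%N)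
  (hp : forall i : nat, (1 <= i <= n)%N -> (0 < p i)%N) :
  exists G : 'I_n.+1 -> {poly {poly int}},
    [/\ forall zeta : R[i], exists l : 'I_n.+1, polyAtZ (G l) zeta != 0,
        forall t : nat,
          \sum_(l < n.+1) polyAtT R (G l) t *
            multLegendre R[i] (fun i => p i * (t + l))%N
                              (fun i => q i * (t + l))%N n = 0
      & (2 <= n)%N -> forall m : nat, (1 <= m < n)%N ->
        (forall i : nat, (1 <= i <= m)%N -> (p i <= p i.+1)%N) ->
        (forall i : nat, (1 <= i <= m)%N -> (q i <= q i.+1)%N) ->
        forall t : nat,
          \sum_(l < n.+1) polyAtT R (G l) t *
            iter m (@Tmap R)
              (multLegendre R[i] (fun i => p i * (t + l))%N
                                 (fun i => q i * (t + l))%N n) = 0 ].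
Proof.
have [g [lj0 glj0] gL] := legendre_recurrence R q hn hp.
set d := (n * _)%N in g lj0 glj0 gL.
pose B (j : nat) : {poly int} := 'X^j * ('X - 1) ^+ (d - j).
pose M := \max_lj size (g lj).
have gM lj : (size (g lj) <= M.+1)%N by rewrite leqW// leq_bigmax.
(* The coefficient of t^i in the l-th coefficient of the recurrence, a polynomial in z. *)
pose c (li : 'I_n.+1 * 'I_M.+1) : {poly int} :=
  \sum_(j < d.+1) (g (li.1, j))`_li.2 *: B j.
have c_neq0 : exists li, c li != 0.
  case: lj0 glj0 => l j glj.
  (* The leading coefficient in t of a nonzero [g (l, j)] survives in [c] by [bernstein_free]. *)
  have sg : ((size (g (l, j))).-1 < M.+1)%N.
    by rewrite (leq_ltn_trans (leq_pred _))// ltnS leq_bigmax.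
  exists (l, Ordinal sg); apply: contraNneq glj => /bernstein_free/(_ j)/=.
  by move/eqP; rewrite -lead_coefE lead_coef_eq0.
have [D [c' [D0 cE [u uc']]]] := remove_common_factor c_neq0.
pose G l : {poly {poly int}} := \poly_(i < M.+1) c' (l, inord i).
have ratr_intr (P : {poly int}) :
    map_poly (ratr : rat -> R[i]) (map_poly intr P) = map_poly intr P.
  by rewrite -map_poly_comp; apply: eq_map_poly => x /=; rewrite ratr_int.
have GL m t : (m < n)%N -> \sum_(l < n.+1) polyAtT R (G l) t *
    iter m (@Tmap R) (multLegendre R[i] (fun i => p i * (t + l))%N
                                        (fun i => q i * (t + l))%N n) = 0.
  (* Multiplication by [D] turns each [c'] back into [c], which leads to [legendre_recurrence]. *)
  move=> mn; apply: (@mulfI _ (map_poly ratr D)); first by rewrite map_poly_eq0.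
  rewrite mulr0 -[RHS](gL t m mn) mulr_sumr.
  transitivity (\sum_(l < n.+1) \sum_(j < d.+1) (eval_int R[i] t (g (l, j)) *:
    ('X^j * ('X - 1) ^+ (d - j))) * iter m (@Tmap R) (multLegendre R[i]
      (fun i => p i * (t + l))%N (fun i => q i * (t + l))%N n)); last first.
    by rewrite pair_bigA; apply: eq_bigr => -[l j] _.
  apply: eq_bigr => l _; rewrite -mulr_suml mulrA; congr (_ * _).
  rewrite /polyAtT horner_poly rmorph_sum mulr_sumr /=.
  under eq_bigr => i _.
    rewrite rmorphM rmorphXn rmorph_nat mulrA /= -(ratr_intr (c' _)) -rmorphM.
    rewrite /= -cE ratr_intr /c rmorph_sum mulr_suml /=.
    over.
  rewrite exchange_big; apply: eq_bigr => j _ /=.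
  have -> : eval_int R[i] t (g (l, j)) =
      \sum_(i < M.+1) ((g (l, j))`_i)%:~R * t%:R ^+ i.
    rewrite /eval_int /= /horner_eval (horner_coef_wide _ (gM _)) rmorph_sum /=.
    by apply: eq_bigr => i _; rewrite rmorphM rmorphXn rmorph_nat.
  rewrite scaler_suml; apply: eq_bigr => i _.
  rewrite inord_val map_polyZ !rmorphM !rmorphXn rmorphB rmorph1 /= map_polyX.
  by rewrite -!mul_polyC polyCM rmorphXn rmorph_nat; ring.
exists G; split => [zeta|t|_ m /andP[_ mn] _ _ t]; [|exact: (GL 0%N)|exact: GL].
(* At a common zero zeta the Bezout relation would read 0 = 1. *)
apply/existsP; apply: contra_eqT (oner_neq0 R[i]) => /existsPn G0.
have c'0 li : (map_poly intr (c' li)).[zeta] = 0 :> R[i].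
  case: li => l i; have /negbNE/eqP/polyP/(_ i) := G0 l.
  rewrite coef0 /polyAtZ coef_map_id0 ?map_poly0 ?horner0//.
  by rewrite coef_poly ltn_ord inord_val.
have := congr1 (fun P => (map_poly ratr P).[zeta]) uc'.
rewrite /= rmorph1 hornerC rmorph_sum horner_sum big1 => [|li _].
  by move/eqP; rewrite eq_sym oner_eq0.
by rewrite rmorphM /= ratr_intr hornerM c'0 mulr0.
Qed.
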